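(* Let $(T,\mathcal T,\mu)$ be a finite positive (not necessarily complete) measure space, $S$ a separable complete metric space, and $N$ a positive integer. Let $\Gamma$ be a multifunction from $T$ to nonempty finite subsets of $S$ of cardinality at most $N$, which is measurable with respect to the $\mu$-completion $\mathcal T_\mu$ of $\mathcal T$. Then there exist $n\le N$ measurable maps $s_i:T_i\to S$, $1\le i\le n$, such that: $T_i\in\mathcal T$ for $1\le i\le n$; there is a set $T_0\in\mathcal T$ of full $\mu$-measure such that $\Gamma(t)=\{s_i(t):t\in T_i,\ 1\le i\le n\}$ for all $t\in T_0$; and if $t\in T_i\cap T_j$ with $i\ne j$ then $s_i(t)\ne s_j(t)$.
   Context: A multifunction $\Gamma$ from $T$ to $S$ assigns to each $t\in T$ a nonempty subset $\Gamma(t)\subset S$; its graph is $G(\Gamma)=\{(t,s)\in T\times S:s\in\Gamma(t)\}$. $\Gamma$ is measurable with respect to a $\sigma$-algebra $\mathcal T'$ on $T$ if $G(\Gamma)\in\mathcal T'\otimes\mathcal B(S)$, where $\mathcal B(S)$ is the Borel $\sigma$-algebra of $S$. A map $s_i:T_i\to S$ is measurable when $T_i$ carries the trace of $\mathcal T$ and $S$ its Borel $\sigma$-algebra. *)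

(* Defs.v *)
From HB Require Import structures.
From mathcomp Require Import all_boot all_order all_algebra.
From mathcomp Require Import all_classical all_reals all_analysis.
From mathcomp Require Import finmap.
Set Implicit Arguments. Unset Strict Implicit. Unset Printing Implicit Defensive.
Import Order.TTheory GRing.Theory Num.Theory.
Local Open Scope classical_set_scope.
Local Open Scope ring_scope.

Definition borel_sets (S : topologicalType) : set (set S) := <<s open >>.

Definition completion_measurable d (T : measurableType d) (R : realType)
  (mu : set T -> \bar R) (A : set T) : Prop :=
  exists B C, [/\ measurable B, measurable C, B `<=` A, A `<=` C
               & mu (C `\` B) = 0%E].

Definition prod_sigma (T S : Type) (F : set (set T)) (G : set (set S))
  : set (set (T * S)) :=
  <<s [set Z | exists X Y, [/\ F X, G Y & Z = X `*` Y]] >>.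

Definition graph_mf (T S : Type) (Gam : T -> set S) : set (T * S) :=
  [set ts | Gam ts.1 ts.2].

Definition borel_measurable_on d (T : measurableType d) (S : topologicalType)
  (D : set T) (f : T -> S) : Prop :=
  forall B, borel_sets B -> measurable (D `&` f @^-1` B).

Definition separable_space (S : topologicalType) : Prop :=
  exists D : set S, countable D /\ closure D = [set: S].

(* Main.v *)
Require Import Defs.
From HB Require Import structures.
From mathcomp Require Import all_boot all_order all_algebra.
From mathcomp Require Import all_classical all_reals all_analysis.
From mathcomp Require Import finmap.
Local Open Scope classical_set_scope.
Local Open Scope ring_scope.
Import Order.TTheory GRing.Theory Num.Theory.

(** Souslin sets over the rectangles "measurable x closed" are closed under
countable unions and intersections, hence include the product sigma-algebra.
By completeness of [S] their projections are Souslin over the measurable sets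
of [T], and such sets are measurable for the completion of [mu] (Lusin and
Sierpinski): this gives the measurable projection theorem. After discarding a
null set the graph of [Gam] lies in the product of the uncompleted
sigma-algebras; projections then yield one measurable selection of its finite
sections, whose graph is removed, and the argument is repeated [N] times. *)

(** * The Souslin operation over a family of sets *)

Section souslin.
Set Implicit Arguments.
Unset Strict Implicit.

Definition agree (m : nat) (a b : nat -> nat) :=
  forall i, (i < m)%N -> a i = b i.

(** Continuity on the Baire space into a discrete target. *)
Definition locally_constant U (f : (nat -> nat) -> U) :=
  forall a, exists m, forall b, agree m a b -> f a = f b.

Lemma agree_le m k a b : (m <= k)%N -> agree k a b -> agree m a b.
Proof. by move=> mk ab i im; apply: ab; exact: leq_trans mk. Qed.

Lemma locally_constant_reindex U (f : (nat -> nat) -> U) (h : nat -> nat) :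
  locally_constant f -> locally_constant (fun a => f (a \o h)).
Proof.
move=> cf a; have [m fm] := cf (a \o h).
exists (\max_(i < m) h i).+1 => b ab; apply: fm => i im /=.
by apply: ab; rewrite ltnS; exact: (leq_bigmax (Ordinal im)).
Qed.

(** The Souslin operation with pieces attached to branches instead of finite sequences: [Q n a]
    depends on a finite prefix of [a] whose length is not tied to [n], so coordinates can be
    reindexed freely. *)
Definition souslin X (P : set (set X)) (E : set X) :=
  exists Q : nat -> (nat -> nat) -> set X,
    [/\ forall n a, P (Q n a), forall n, locally_constant (Q n)
      & E = [set x | exists a, forall n, Q n a x]].

Context (X : Type) (P : set (set X)).

Lemma souslin_sub E : P E -> souslin P E.
Proof.
move=> PE; exists (fun _ _ => E); split=> //; first by move=> n a; exists 0%N.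
by apply/seteqP; split=> [x Ex|x [_ /(_ 0%N)]] //; exists (fun=> 0%N).
Qed.

(** The first coordinate of a branch selects [k]; its tail is a branch for [E k]. *)
Lemma souslin_bigcup (E : nat -> set X) :
  (forall k, souslin P (E k)) -> souslin P (\bigcup_k E k).
Proof.
move=> /choice[Q QE].
exists (fun n a => Q (a 0%N) n (a \o succn)); split.
- by move=> n a; have [] := QE (a 0%N).
- move=> n a; have [_ /(_ n) + _] := QE (a 0%N).
  move=> /(locally_constant_reindex succn)/(_ a)[m fm].
  exists m.+1 => b ab; rewrite -(ab 0%N)//; apply: fm.
  exact: agree_le ab.
- apply/seteqP; split=> [x [k _]|x [a aQ]].
    have [_ _ ->] := QE k; move=> [a aQ].
    by exists (fun i => if i is j.+1 then a j else k).
  by exists (a 0%N) => //; have [_ _ ->] := QE (a 0%N); exists (a \o succn).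
Qed.

Lemma souslin_bigcap (E : nat -> set X) :
  (forall k, souslin P (E k)) -> souslin P (\bigcap_k E k).
Proof.
move=> /choice[Q QE].
(* One branch encodes countably many: [a \o h k] is the branch for [E k]. Indices coding no pair
   merely repeat a condition on [E 0]. *)
pose h (k i : nat) : nat := choice.pickle (k, i).
exists (fun n a => if choice.unpickle n is Some kj then
  Q kj.1 kj.2 (a \o h kj.1) else Q 0%N 0%N (a \o h 0%N)); split.
- by move=> n a; case: (choice.unpickle n) => [kj|]; [have [] := QE kj.1|have [] := QE 0%N].
- move=> n; case: (choice.unpickle n) => [[k j]|] /=; apply: (locally_constant_reindex (h _)).
    by have [] := QE k.
  by have [] := QE 0%N.
- apply/seteqP; split=> [x Ex|x [a aQ] k _].
    have /choice[a aQ] : forall k, exists a, forall n, Q k n a x.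
      by move=> k; have := Ex k I; have [_ _ ->] := QE k.
    pose b n := if choice.unpickle n is Some ki then a ki.1 ki.2 else 0%N.
    have bh k : b \o h k = a k.
      by apply/funext => i; rewrite /b /h /= (choice.pickleK (k, i)).
    by exists b => n; case: (choice.unpickle n) => [kj|]; rewrite bh.
  have [_ _ ->] := QE k; exists (a \o h k) => n.
  by have := aQ (choice.pickle (k, n)); rewrite choice.pickleK.
Qed.

(** Souslin sets need not be stable under complement; imposing the condition on both sides repairs
    this, and De Morgan exchanges unions and intersections. *)
Lemma sigma_algebra_souslin : P set0 -> P setT ->
  sigma_algebra setT [set E | souslin P E /\ souslin P (~` E)].
Proof.
move=> P0 PT; split=> /=.
- by rewrite setC0; split; exact: souslin_sub.
- by move=> A [sA sAc]; rewrite setTD setCK.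
- move=> A sA; rewrite setC_bigcup; split.
    by apply: souslin_bigcup => k; have [] := sA k.
  by apply: souslin_bigcap => k; have [] := sA k.
Qed.

End souslin.

(** * Measurability of Souslin sets for the completion of a finite measure *)

Section souslin_measurable.
Set Implicit Arguments.
Unset Strict Implicit.
Context d (T : measurableType d) (R : realType).
Variable mu : {finite_measure set T -> \bar R}.

(** [H] is the intersection of measurable covers whose measures approach the infimum [c]. Its
    intersection with any measurable cover is again a cover, so has measure at least [c], hence at
    least [mu H]. *)
Lemma measurable_hull (A : set T) : exists H, [/\ measurable H, A `<=` H &
  forall C, measurable C -> A `<=` C -> mu (H `\` C) = 0%E].
Proof.
pose cover := [set C | measurable C /\ A `<=` C].
pose c := ereal_inf [set mu C | C in cover].
have c_fin : c \is a fin_num.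
  apply/fin_numPlt; apply/andP; split.
    apply: (@lt_le_trans _ _ 0%E) => //.
    by apply: le_ereal_inf_tmp => _ [C _ <-].
  apply: (@le_lt_trans _ _ (mu setT)).
    by apply: ereal_inf_lbound; exists setT => //; split.
  by rewrite ltey_eq fin_num_measure.
have /choice[C CP] (n : nat) : exists C, cover C /\ (mu C <= c + n.+1%:R^-1%:E)%E.
  have n0 : 0 < n.+1%:R^-1 :> R by rewrite invr_gt0.
  have [_ [C cC <-] /ltW Cc] := lb_ereal_inf_adherent n0 c_fin.
  by exists C.
have mC n : measurable (C n) by have [[]] := CP n.
have mH : measurable (\bigcap_n C n) by exact: bigcap_measurable.
exists (\bigcap_n C n); split => //.
  by move=> t At n _; have [[_ +] _] := CP n; exact.
move=> D mD AD.
have mHD : measurable (\bigcap_n C n `&` D) by exact: measurableI.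
have Hc : (mu (\bigcap_n C n) <= c)%E.
  apply/lee_addgt0Pr => e e0.
  have [n _ /(_ n (leqnn n)) /= ne] := near_infty_natSinv_lt (PosNum e0).
  apply: (@le_trans _ _ (mu (C n))).
    by apply: le_measure; [exact: mem_set|exact: mem_set|move=> t; exact].
  have [_ Cc] := CP n; apply: (le_trans Cc).
  by rewrite leeD2l// lee_fin ltW.
have cH : (c <= mu (\bigcap_n C n `&` D))%E.
  apply: ereal_inf_lbound; exists (\bigcap_n C n `&` D) => //; split => //.
  by move=> t At; split; [move=> n _; have [[_ +] _] := CP n; exact|exact: AD].
apply/eqP; rewrite -measure_le0 measureD//; last by rewrite ltey_eq fin_num_measure.
by rewrite sube_le0; exact: le_trans cH.
Qed.

(* Lusin--Sierpinski: outside a null set, a point of the hull of the piece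
   indexed by a finite sequence lies in the hull of one of its extensions;
   iterating produces a branch witnessing membership in the Souslin set. *)
Lemma souslin_completion_measurable (A : set T) :
  souslin measurable A -> completion_measurable mu A.
Proof.
move=> [Q [mQ cQ AE]].
pose cyl (u : seq nat) := [set a | forall i, (i < size u)%N -> a i = nth 0%N u i].
pose X u := [set t | exists2 a, cyl u a & forall n, Q n a t].
have XE u : X u = \bigcup_k X (rcons u k).
  apply/seteqP; split=> [t [a ua aQ]|t [k _] [a ua aQ]].
    exists (a (size u)) => //; exists a => // i; rewrite size_rcons ltnS nth_rcons.
    by case: ltngtP => // [iu _|-> _]; [exact: ua|].
  exists a => // i iu; have := ua i; rewrite size_rcons nth_rcons iu; apply.
  exact: ltnW.
have /choice[H HP] u := measurable_hull (X u).
have mH u : measurable (H u) by have [] := HP u.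
have XH u : X u `<=` H u by have [] := HP u.
have HX u C : measurable C -> X u `<=` C -> mu (H u `\` C) = 0%E.
  by have [_ _] := HP u; exact.
pose det u n := forall a b, cyl u a -> cyl u b -> Q n a = Q n b.
(* The piece [Q n], evaluated at [u] extended by zeros, once the word [u] determines it; until then
   no condition is imposed. *)
pose D u n := if pselect (det u n) then Q n (nth 0%N u) else setT.
have XD u n : X u `<=` D u n.
  rewrite /D; case: pselect => // du t [a ua]/(_ n).
  by rewrite (du a (nth 0%N u)).
have mD u n : measurable (D u n) by rewrite /D; case: pselect => ? //=; exact: mQ.
pose N1 u := H u `\` \bigcup_k H (rcons u k).
pose N2 u := \bigcup_n (H u `\` D u n).
pose N := \bigcup_u (N1 u `|` N2 u).
have mN1 u : measurable (N1 u).
  by apply: measurableD => //; exact: bigcup_measurable.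
have mN2 u : measurable (N2 u).
  by apply: bigcup_measurable => n _; exact: measurableD.
(* Words are enumerated by their codes, which makes [N] a countable union. *)
pose N' o := if o is Some u then N1 u `|` N2 u else set0.
have NE : N = \bigcup_k N' (choice.unpickle k).
  apply/seteqP; split=> [t [u _ Nt]|t [k _]].
    by exists (choice.pickle u); rewrite ?choice.pickleK.
  by rewrite /N'; case: choice.unpickle => // u Nt; exists u.
have mN : measurable N.
  rewrite NE; apply: bigcup_measurable => k _.
  by rewrite /N'; case: choice.unpickle => [u|//]; exact: (measurableU _ _ (mN1 u) (mN2 u)).
have N0 : mu N = 0%E.
  apply: measure_negligible => //; rewrite NE; apply: negligible_bigcup => k.
  rewrite /N'; case: choice.unpickle => [u|]; last exact: negligible_set0.
  (* Both sets are null by minimality of [H u]: the hulls of the extensions together cover [X u],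
     and so does each [D u n]. *)
  apply: negligibleU.
    apply/(negligibleP mu (mN1 u)); apply: HX; first exact: bigcup_measurable.
    by rewrite XE => t [j _ ?]; exists j => //; exact: XH.
  apply: negligible_bigcup => n.
  by apply/negligibleP; [exact: measurableD|exact: HX].
exists (H [::] `\` N), (H [::]); split => //.
- exact: measurableD.
- move=> t [Ht Nt].
  have step u : exists k, H u t -> H (rcons u k) t.
    have [Hut|] := pselect (H u t); last by exists 0%N.
    have [[k _ Hk]|nH] := pselect ((\bigcup_k H (rcons u k)) t).
      by exists k.
    by exfalso; apply: Nt; exists u => //; left.
  have [next nextP] := choice step.
  pose br := fix br n := if n is m.+1 then rcons (br m) (next (br m)) else [::].
  pose a n := next (br n).
  have brE n : br n = mkseq a n by elim: n => // n IH; rewrite mkseqS -IH.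
  have Hbr n : H (br n) t by elim: n => //= n ?; exact: nextP.
  rewrite AE /=; exists a => n.
  (* A prefix of length [m] fixes [Q n], so [D (br m) n] is [Q n a]; it contains [t], which avoids
     [N2 (br m)]. *)
  have [m am] := cQ n a.
  have cyla b : cyl (br m) b -> agree m a b.
    move=> bb i im; have := bb i; rewrite brE size_mkseq => -> //.
    by rewrite nth_mkseq.
  have db : det (br m) n.
    by move=> b c /cyla/am <- /cyla/am <-.
  have : D (br m) n t.
    apply: contrapT => Dt; apply: Nt; exists (br m) => //; right.
    by exists n.
  rewrite /D; case: pselect => // dm /=.
  by rewrite -(am (nth 0%N (br m)))//; exact: cyla.
- by rewrite AE => t [a aQ]; apply: XH; exists a.
- apply: (subset_measure0 _ mN _ N0); first by apply: measurableD => //; exact: measurableD.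
  by rewrite setDD => t [].
Qed.

End souslin_measurable.

(** * Measurable projection along a separable complete space *)

Section projection.
Set Implicit Arguments.
Unset Strict Implicit.

Definition open_basis (S : topologicalType) (U : nat -> set S) :=
  (forall n, open (U n)) /\
  (forall x O, open O -> O x -> exists2 n, U n x & U n `<=` O).

Lemma separable_open_basis (R : realType) (S : pseudoMetricType R) :
  separable_space S -> exists U : nat -> set S, open_basis U.
Proof.
move=> [D [/countable_injP[f f_inj] clD]].
(* Basic sets are interiors of balls around dense points. The union has at most one term, [f] being
   injective on [D]; it spares inverting [f]. *)
pose V (k j : nat) : set S :=
  (\bigcup_(y in [set y | D y /\ f y = j]) ball y k.+1%:R^-1)°.
pose W (o : option (nat * nat)) := if o is Some kj then V kj.1 kj.2 else set0.
exists (fun n => W (choice.unpickle n)); split.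
  by move=> n; rewrite /W; case: choice.unpickle => [kj|];
    [exact: open_interior|exact: open0].
move=> x O oO Ox.
have /nbhs_ballP[e /= e0 eO] : nbhs x O by exact: open_nbhs_nbhs.
have e20 : 0 < e / 2 by rewrite divr_gt0.
have [k _ /(_ k (leqnn k)) /= ke] := near_infty_natSinv_lt (PosNum e20).
have k0 : 0 < k.+1%:R^-1 :> R by rewrite invr_gt0.
have k20 : 0 < k.+1%:R^-1 / 2 :> R by rewrite divr_gt0.
have [y [Dy xy]] : D `&` ball x (k.+1%:R^-1 / 2) !=set0.
  have : closure D x by rewrite clD.
  by apply; exact: nbhsx_ballx.
exists (choice.pickle (k, f y)); rewrite choice.pickleK /W /V /=.
  apply/nbhs_ballP; exists (k.+1%:R^-1 / 2) => //= z xz.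
  by exists y => //; apply: (ball_split (ball_sym xy)).
move=> z /interior_subset[y' [Dy' fy'] yz]; apply: eO.
have yy : y' = y by apply: f_inj => //; exact: mem_set.
rewrite {}yy in yz; apply: (@ball_split _ _ y); last first.
  by apply: le_ball yz; exact: ltW.
apply: le_ball xy; apply: ltW; apply: (le_lt_trans _ ke).
by rewrite ler_piMr ?(ltW k0)// invf_le1// ler1n.
Qed.

Lemma locally_constant_le U (f : nat -> (nat -> nat) -> U) :
  (forall k, locally_constant (f k)) -> forall n a, exists m, forall b,
    agree m a b -> forall k, (k <= n)%N -> f k a = f k b.
Proof.
move=> cf n a; have /choice[m mP] k := cf k a.
exists (\max_(k < n.+1) m k) => b ab k kn; apply: mP.
by apply: agree_le ab; exact: (leq_bigmax (Ordinal (kn : (k < n.+1)%N))).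
Qed.

Definition closed_rectangle d (T : measurableType d) (S : topologicalType) :
    set (set (T * S)) :=
  [set Z | exists A F, [/\ measurable A, closed F & Z = A `*` F]].

Context d (T : measurableType d) (R : realType) (S : completePseudoMetricType R).

(** An open set is a countable union of closed sets: [F n] removes the interiors of the balls of
    radius [1/(n+1)] centred outside [O]. *)
Lemma open_souslin (O : set S) : open O ->
  souslin (@closed_rectangle _ T S) ([set: T] `*` O).
Proof.
move=> oO.
pose F n : set S := ~` \bigcup_(y in ~` O) (ball y n.+1%:R^-1)°.
have -> : [set: T] `*` O = \bigcup_n ([set: T] `*` F n).
  apply/seteqP; split=> -[t s] /=.
    move=> [_ Os].
    have /nbhs_ballP[e /= e0 eO] : nbhs s O by exact: open_nbhs_nbhs.
    have [k _ /(_ k (leqnn k)) /= ke] := near_infty_natSinv_lt (PosNum e0).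
    exists k => //; split => // -[y nOy /interior_subset /ball_sym sy].
    by apply: nOy; apply: eO; apply: le_ball sy; exact: ltW.
  move=> [n _ [_ Fs]]; split => //; apply: contrapT => nOs; apply: Fs.
  by exists s => //; apply: nbhsx_ballx; rewrite invr_gt0.
apply: souslin_bigcup => n; apply: souslin_sub; exists setT, (F n); split => //.
apply: open_closedC; apply: bigcup_open => y _; exact: open_interior.
Qed.

(** Two nested generation arguments: rectangles generate the product, and the sets [C] whose
    cylinder over [T] is good form a sigma-algebra containing the open sets. *)
Lemma measurable_souslin (E : set (T * g_sigma_algebraType (@open S))) :
  measurable E -> souslin (@closed_rectangle _ T S) (E : set (T * S)).
Proof.
rewrite measurable_prod_measurableType => mE.
pose G : set (set (T * S)) := [set E | souslin (@closed_rectangle _ T S) E /\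
  souslin (@closed_rectangle _ T S) (~` E)].
have sG : sigma_algebra setT G.
  apply: sigma_algebra_souslin.
    by exists set0, set0; split; [by []|exact: closed0|rewrite setX0].
  by exists setT, setT; split; [by []|exact: closedT|rewrite setXTT].
have [_ _ _ GI] := (sigma_algebraP (fun X _ => @subsetT _ X)).1 sG.
have [G0 GC GU] := sG.
suff : G E by case.
apply: (smallest_sub sG _ mE) => _ [A mA [B mB <-]].
have -> : A `*` B = (A `*` [set: S]) `&` ([set: T] `*` B).
  by rewrite -setXI setIT setTI.
apply: GI.
  split; apply: souslin_sub; first by exists A, setT; split => //; exact: closedT.
  exists (~` A), setT; split; [exact: measurableC|exact: closedT|].
  by apply/seteqP; split=> -[t s] /=; [move=> nA; split => // At; apply: nA|move=> [nA _] []].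
have preT (C : set S) : [set: T] `*` C = snd @^-1` C.
  by apply/seteqP; split=> -[t s] // [].
have sGS : sigma_algebra setT [set C : set S | G ([set: T] `*` C)].
  split=> /=; first by rewrite setX0.
    by move=> C /GC; rewrite !setTD !preT preimage_setC.
  by move=> C /GU; rewrite preT preimage_bigcup; under eq_bigcupr do rewrite preT.
apply: (smallest_sub sGS _ mB) => O oO; split; first exact: open_souslin.
apply: souslin_sub; exists setT, (~` O); split => //; first exact: open_closedC.
by rewrite !preT preimage_setC.
Qed.

(* With [V k j] running over sets of radius [1/(k+1)], completeness makes the
   nonemptiness of the finite intersections [G a n] equivalent to that of the
   full intersection, which is how the coordinate in [S] is eliminated. *)
Lemma souslin_fst (E : set (T * S)) : separable_space S ->
  souslin (@closed_rectangle _ T S) E -> souslin measurable (fst @` E).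
Proof.
move=> /separable_open_basis[U [_ UP]] [Q [PQ cQ ->]].
(* The two sides are chosen as a function of the set alone, so they inherit the local constancy of
   [Q k]. *)
have /choice[AF AFP] (Z : set (T * S)) : exists AF : set T * set S,
    @closed_rectangle _ T S Z -> [/\ measurable AF.1, closed AF.2 & Z = AF.1 `*` AF.2].
  have [[A [F ?]]|nZ] := pselect (@closed_rectangle _ T S Z); first by exists (A, F).
  by exists (set0, set0) => /nZ.
(* [V k j] is [U j] when that set fits in a ball of radius [1/(k+1)], and empty otherwise. Even
   coordinates of a branch run through the scheme [Q], odd ones choose the index [j] at each stage
   [k]. *)
pose V k j := [set s | exists2 y, U j `<=` ball y (k.+1%:R^-1 : R) & U j s].
pose h k (a : nat -> nat) := (AF (Q k (a \o double)), V k (a k.*2.+1)).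
have ch k : locally_constant (h k).
  move=> a.
  have [m am] := @locally_constant_reindex _ _ double (cQ k) a.
  exists (maxn m k.*2.+2) => b ab; rewrite /h (ab k.*2.+1) ?leq_max ?leqnn ?orbT//.
  by rewrite (am b)//; apply: agree_le ab; exact: leq_maxl.
pose G n a := \bigcap_(k in [set k | (k <= n)%N]) ((h k a).1.2 `&` (h k a).2).
(* Nonemptiness of [G n a] does not involve the point of [T], so the second factor is everything or
   empty, hence measurable. *)
exists (fun n a => (h n a).1.1 `&` [set _ | G n a !=set0]); split.
- move=> n a; have [mA _ _] := AFP _ (PQ n (a \o double)).
  have [nG|nG] := pselect (G n a !=set0).
    by rewrite (_ : [set _ | _] = setT) ?setIT//; apply/seteqP; split.
  by rewrite (_ : [set _ | _] = set0) ?setI0//; apply/seteqP; split.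
- move=> n a; have [m am] := locally_constant_le ch n a.
  exists m => b /am ab; rewrite (ab n)//; congr (_ `&` _).
  rewrite (_ : G n a = G n b)//; apply: eq_bigcapr => k kn.
  by rewrite (ab k kn).
- apply/seteqP; split=> [_ [[t s] [a aQ] <-]|t [a aQ]] /=.
    have /choice[b bV] (k : nat) : exists j, V k j s.
      have k0 : 0 < k.+1%:R^-1 :> R by rewrite invr_gt0.
      have [j Uj jb] := UP s _ (open_interior (ball s k.+1%:R^-1)) (nbhsx_ballx _ _ k0).
      by exists j, s => //; apply: subset_trans jb _; exact: interior_subset.
    exists (fun i => if odd i then b i./2 else a i./2) => n.
    set c := fun i => _.
    have ca : c \o double = a.
      by apply/funext => i; rewrite /c /= odd_double doubleK.
    have cb k : c k.*2.+1 = b k by rewrite /c /= odd_double /= uphalf_double.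
    have Qts k : ((AF (Q k a)).1 `*` (AF (Q k a)).2) (t, s).
      by have [_ _ <-] := AFP _ (PQ k a); exact: aQ.
    rewrite /G /h ca /=; split; first by have [] := Qts n.
    exists s => k /= _; rewrite cb; split => //.
    by have [] := Qts k.
  (* From index [k] on, the points [s n] lie in one ball of radius [1/(k+1)]: the sequence is
     Cauchy, and its limit belongs to every closed side. *)
  have /choice[s sG] n : exists s, G n a s by have [] := aQ n.
  have sc : cvg (s @ \oo).
    apply: cauchy_cvg; apply/cauchyP => e e0.
    have [k _ /(_ k (leqnn k)) /= ke] := near_infty_natSinv_lt (PosNum e0).
    have [_ [y Uy _]] := sG k k (leqnn k).
    exists y; exists k => // n /= kn.
    have [_ [_ _ Us]] := sG n k kn.
    by apply: (le_ball (ltW ke)); exact: Uy.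
  exists (t, lim (s @ \oo)) => //; exists (a \o double) => n.
  have [_ cF ->] := AFP _ (PQ n (a \o double)); split => /=.
    by have [] := aQ n.
  apply: (closed_cvg _ cF _ _ sc); exists n => // k /= nk.
  by have [] := sG k n nk.
Qed.

Lemma measurable_projection (mu : {finite_measure set T -> \bar R})
    (E : set (T * g_sigma_algebraType (@open S))) :
  separable_space S -> measurable E -> completion_measurable mu (fst @` E).
Proof.
move=> sS mE; apply: souslin_completion_measurable.
exact: souslin_fst (measurable_souslin mE).
Qed.

End projection.

(** * Measurable selection and enumeration of finite sections *)

Section selection.
Set Implicit Arguments.
Unset Strict Implicit.

(** Otherwise each of the finitely many points of [F 0] leaves the sequence at some index, and at
    the largest of these nothing remains. *)
Lemma finite_bigcap_nonempty (X : eqType) (F : nat -> set X) :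
  finite_set (F 0%N) -> (forall n, F n.+1 `<=` F n) ->
  (forall n, F n !=set0) -> \bigcap_n F n !=set0.
Proof.
move=> /finite_seqP[l F0l] dF F0.
have mF m n : (m <= n)%N -> F n `<=` F m.
  elim: n => [|n IH]; first by rewrite leqn0 => /eqP ->.
  rewrite leq_eqVlt => /predU1P[-> //|mn]; apply: subset_trans (dF n) _.
  exact: IH.
apply: contrapT => nF.
have /choice[k kF] (x : X) : exists n, ~ F n x.
  apply: contrapT => Fx; apply: nF; exists x => n _; apply: contrapT => nFx.
  by apply: Fx; exists n.
have [x Fx] := F0 (\max_(y <- l) k y).
have xl : x \in l by have := mF _ _ (leq0n _) _ Fx; rewrite F0l.
by apply: (kF x); apply: mF Fx; exact: leq_bigmax_seq.
Qed.

Context d (T : measurableType d) (R : realType).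
Variable mu : {finite_measure set T -> \bar R}.

Context (S : completePseudoMetricType R).
Let BS := g_sigma_algebraType (@open S).

(** The sets with this property form a sigma-algebra. For a rectangle, replace the side in [T] by
    its inner approximation [B] and discard [C] minus [B]. *)
Lemma completion_prod_sigma_ae (E : set (T * S)) :
  prod_sigma (completion_measurable mu) (@borel_sets S) E ->
  exists (E' : set (T * BS)) (N : set T),
    [/\ measurable E', measurable N, mu N = 0%E &
      forall t x, ~ N t -> E (t, x) <-> E' (t, x)].
Proof.
pose G (F : set (T * S)) := exists (F' : set (T * BS)) (N : set T),
  [/\ measurable F', measurable N, mu N = 0%E &
    forall t x, ~ N t -> F (t, x) <-> F' (t, x)].
move=> pE; apply: (@smallest_sub _ _ _ G _ _ _ pE); last first.
  move=> _ [X [Y [[B [C [mB mC BX XC CB0]]] mY ->]]].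
  exists (B `*` (Y : set BS)), (C `\` B); split => //.
  - exact: measurableX.
  - exact: measurableD.
  - move=> t x nCB; split=> -[] /= h Yx; split => //=; last exact: BX.
    by apply: contrapT => nB; apply: nCB; split => //; exact: XC.
split.
- by exists set0, set0.
- move=> A [A' [N [mA mN N0 AA]]]; exists (~` A'), N; split => //.
    exact: measurableC.
  by move=> t x /(AA t x) h; rewrite setTD; split; apply: contra_not; apply h.
- move=> A /choice[A'] /choice[N] AP.
  exists (\bigcup_n A' n), (\bigcup_n N n); split.
  + by apply: bigcup_measurable => n _; have [] := AP n.
  + by apply: bigcup_measurable => n _; have [] := AP n.
  + apply: measure_negligible.
      by apply: bigcup_measurable => n _; have [] := AP n.
    by apply: negligible_bigcup => n; have [_ ? ? _] := AP n; apply/negligibleP.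
  + move=> t x nN; have AA n : A n (t, x) <-> A' n (t, x).
      by have [_ _ _] := AP n; apply => Nt; apply: nN; exists n.
    by split=> -[n _ /AA ?]; exists n.
Qed.

Context (U : nat -> set S) (UB : open_basis U).

Lemma borel_measurable_on_basis (D : set T) (s : T -> S) : measurable D ->
  (forall n, measurable (D `&` s @^-1` (U n))) -> borel_measurable_on D s.
Proof.
move=> mD ms; suff : measurable_fun D (s : T -> BS) by move=> + B mB; exact.
apply: (@measurability _ _ T BS D s (@open S)) => // _ [] O oO <-.
rewrite (_ : O = \bigcup_n (if pselect (U n `<=` O) then U n else set0)).
  rewrite preimage_bigcup setI_bigcupr; apply: bigcup_measurable => n _.
  by case: pselect => ? //=; rewrite preimage_set0 setI0.
apply/seteqP; split=> [x Ox|x [n _]].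
  have [n Ux UO] := UB.2 _ _ oO Ox.
  by exists n => //; case: pselect.
by case: pselect => //= UO /UO.
Qed.

Hypotheses (hS : hausdorff_space S) (sS : separable_space S).

Lemma open_basis_separates x y : x <> y -> exists2 n, U n x & ~ U n y.
Proof.
move=> /eqP xy; move: hS; rewrite open_hausdorff => /(_ _ _ xy).
move=> [[A B] /= [/set_mem Ax /set_mem By] [oA oB /eqP AB0]].
have [n Ux UA] := UB.2 _ _ oA Ax; exists n => // /UA Ay.
by have : (A `&` B) y by []; rewrite AB0.
Qed.

(* Shrink the sections, keeping in turn only the points in [U n] wherever there
   are some: finite sections stabilise, and what remains is a single point since
   the [U n] separate points. *)
Lemma finite_sections_selection (E : set (T * BS)) : measurable E ->
  (forall t, finite_set [set x | E (t, x)]) ->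
  exists (D : set T) (s : T -> S) (N : set T),
    [/\ measurable D, borel_measurable_on D s, measurable N /\ mu N = 0%E,
      forall t, D t -> E (t, s t) & forall t x, ~ N t -> E (t, x) -> D t].
Proof.
move=> mE finE.
(* [B Z] and [C Z] approximate the projection of [Z] from inside and outside; they stand in for it,
   as it is measurable only for the completion. *)
have /choice[B] (Z : set (T * BS)) : exists B, exists C : set T, measurable Z ->
    [/\ measurable B, measurable C, B `<=` fst @` Z, fst @` Z `<=` C
      & mu (C `\` B) = 0%E].
  have [mZ|nmZ] := pselect (measurable Z); last by exists set0, set0.
  by have [B [C ?]] := measurable_projection mu sS mZ; exists B, C.
move=> /choice[C BC].
pose W n (Z : set (T * BS)) := Z `&` snd @^-1` (U n).
pose next n Z := W n Z `|` (Z `&` fst @^-1` (~` B (W n Z))).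
pose F := fix F n := if n is m.+1 then next m (F m) else E.
have mU n : measurable (snd @^-1` (U n) : set (T * BS)).
  rewrite -[_ @^-1` _]setTI; apply: (@measurable_snd _ _ T BS) => //.
  by apply: sub_sigma_algebra; exact: UB.1.
have mfst (A : set T) : measurable A -> measurable (fst @^-1` A : set (T * BS)).
  by move=> mA; rewrite -[_ @^-1` _]setTI; exact: (@measurable_fst _ _ T BS).
have mW n Z : measurable Z -> measurable (W n Z) by move=> ?; exact: measurableI.
have mF n : measurable (F n).
  elim: n => //= n IH; apply: measurableU; first exact: mW.
  apply: measurableI => //; apply: mfst; apply: measurableC.
  by have [] := BC _ (mW n _ IH).
pose N := (C E `\` B E) `|` \bigcup_n (C (W n (F n)) `\` B (W n (F n))).
have mCB Z : measurable Z -> measurable (C Z `\` B Z).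
  by move=> /BC[? ? _ _ _]; exact: measurableD.
have mN : measurable N.
  apply: measurableU; first exact: mCB.
  by apply: bigcup_measurable => n _; apply: mCB; exact: mW.
have negCB Z : measurable Z -> mu.-negligible (C Z `\` B Z).
  by move=> mZ; have [_ _ _ _ ?] := BC _ mZ; apply/negligibleP; first exact: mCB.
have N0 : mu N = 0%E.
  apply: measure_negligible => //; apply: negligibleU; first exact: negCB.
  by apply: negligible_bigcup => n; apply: negCB; exact: mW.
pose D := B E `\` N.
have mD : measurable D by apply: measurableD => //; have [] := BC _ mE.
have FB n t x : B (W n (F n)) t -> F n.+1 (t, x) -> U n x.
  by move=> Bt [[_]|[_ /=]].
have WB n t x : D t -> F n (t, x) -> U n x -> B (W n (F n)) t.
  move=> [_ Nt] Fx Ux; apply: contrapT => nB; apply: Nt; right; exists n => //.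
  have [_ _ _ WC _] := BC _ (mW n _ (mF n)).
  by split => //; apply: WC; exists (t, x).
have Fdec n t x : F n.+1 (t, x) -> F n (t, x) by move=> [[]|[]].
have Fne n t : D t -> exists x, F n (t, x).
  move=> Dt; elim: n => [|n [x Fx]].
    have [_ _ BE _ _] := BC _ mE.
    by have [/BE[[t' x] Ex /= <-] _] := Dt; exists x.
  have [Bt|nB] := pselect (B (W n (F n)) t); last by exists x; right.
  have [_ _ BW _ _] := BC _ (mW n _ (mF n)).
  by have [[t' y] Wy /= tt] := BW _ Bt; subst t'; exists y; left.
have /choice[s sP] t : exists x, D t -> forall n, F n (t, x).
  have [Dt|nD] := pselect (D t); last by exists point.
  have [x xF] : \bigcap_n [set x : S | F n (t, x)] !=set0.
    apply: finite_bigcap_nonempty => [|n x|n]; first exact: finE.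
      exact: Fdec.
    exact: Fne.
  by exists x => _ n; exact: xF.
exists D, s, N; split => //.
(* On [D], [s t] is in [U n] exactly when [t] is in [B (W n (F n))]: there stage [n] kept only
   points of [U n], and elsewhere on [D] the section of [F n] misses [U n]. *)
- apply: borel_measurable_on_basis => // n.
  rewrite (_ : _ `&` _ = D `&` B (W n (F n))).
    by apply: measurableI => //; have [] := BC _ (mW n _ (mF n)).
  apply/seteqP; split=> t [Dt h]; split => //.
    by apply: WB h => //; exact: sP.
  by apply: FB h _; exact: sP.
- by move=> t Dt; exact: (sP t Dt 0%N).
- move=> t x nN Ex; split => //; apply: contrapT => nB; apply: nN; left.
  by split => //; have [_ _ _ + _] := BC _ mE; apply; exists (t, x).
Qed.

(** Induction on [N], each step removing the graph of one selection. Bounding sections by lists lets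
    the bound drop by deleting [s t] from the list. *)
Lemma finite_sections_enumeration (N : nat) (E : set (T * BS)) : measurable E ->
  (forall t, exists2 l : seq S, (size l <= N)%N & forall x, E (t, x) -> x \in l) ->
  exists (Ti : nat -> set T) (s : nat -> T -> S) (Z : set T),
    [/\ forall i, measurable (Ti i) /\ borel_measurable_on (Ti i) (s i),
      measurable Z /\ mu Z = 0%E,
      forall i t, Ti i t -> E (t, s i t),
      forall t x, ~ Z t -> E (t, x) -> exists2 i, (i < N)%N & Ti i t /\ s i t = x
      & forall i j t, i != j -> Ti i t -> Ti j t -> s i t != s j t].
Proof.
elim: N E => [|N IH] E mE lE.
  exists (fun=> set0), (fun _ _ => point), set0; split=> //.
    by move=> i; split => // A _; rewrite set0I.
  by move=> t x _ Ex; have [[|//] _ /(_ _ Ex)] := lE t.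
have finE t : finite_set [set x | E (t, x)].
  by have [l _ El] := lE t; apply: sub_finite_set (finite_seq l) => x; exact: El.
have [D [s [Z [mD ms [mZ Z0] DE ED]]]] := finite_sections_selection mE finE.
(* Measurability of the condition that [x] differs from [s t] comes from writing it as a countable
   union: some [U n] contains [s t] but not [x]. *)
pose E' := E `&` fst @^-1` (~` Z) `&` \bigcup_n ((D `&` s @^-1` (U n)) `*` (~` U n : set BS)).
have mE' : measurable E'.
  have mU n : measurable (U n : set BS) by apply: sub_sigma_algebra; exact: UB.1.
  apply: measurableI; first apply: measurableI => //.
    by rewrite -[_ @^-1` _]setTI; apply: (@measurable_fst _ _ T BS) => //; exact: measurableC.
  apply: bigcup_measurable => n _; apply: measurableX; last exact: measurableC.
  by apply: ms; exact: mU.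
have E's t x : E' (t, x) -> [/\ E (t, x), D t & x != s t].
  move=> [[Ex _] [n _ [[Dt /= Us] /= nU]]]; split => //.
  by apply/eqP => xs; apply: nU; rewrite xs.
have [t|Ti [s' [Z' [mTs [mZ' Z'0] TE ET Tij]]]] := IH E' mE'.
  have [l lN El] := lE t.
  have [Dt|nD] := pselect (D t); last by exists [::] => // x /E's[].
  have sl : s t \in l by apply: El; exact: DE.
  exists (rem (s t) l); first by rewrite size_rem// -ltnS (leq_trans _ lN)// ltn_predL; case: l sl {El lN}.
  by move=> x /E's[/El xl _ xs]; exact: rem_mem.
exists (fun i => if i is j.+1 then Ti j else D),
  (fun i => if i is j.+1 then s' j else s), (Z `|` Z'); split.
- by case.
- split; first exact: measurableU.
  by apply: measure_negligible; [exact: measurableU|apply: negligibleU; exact/negligibleP].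
- by case=> [|i] t; [exact: DE|move=> /TE/E's[]].
- move=> t x /not_orP[nZ nZ'] Ex; have Dt := ED _ _ nZ Ex.
  have [sx|/eqP sx] := eqVneq (s t) x; first by exists 0%N.
  have [n Us nU] := open_basis_separates sx.
  have [|i iN ?] := ET t x nZ'; last by exists i.+1.
  by split; [split|exists n].
- case=> [|i] [|j] t //= ij.
  + by move=> _ /TE/E's[_ _]; rewrite eq_sym.
  + by move=> /TE/E's[_ _].
  + exact: Tij.
Qed.

End selection.

Theorem theoremA6 (d : measure_display) (T : measurableType d) (R : realType)
  (mu : {finite_measure set T -> \bar R})
  (S : completePseudoMetricType R) (N : nat) (Gam : T -> set S) :
  hausdorff_space S ->
  separable_space S ->
  (0 < N)%N ->
  (forall t, [/\ Gam t !=set0, finite_set (Gam t)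
               & (#|` fset_set (Gam t)| <= N)%N]) ->
  prod_sigma (completion_measurable mu) (@borel_sets S) (graph_mf Gam) ->
  exists n : nat, (n <= N)%N /\
  exists (Ti : 'I_n -> set T) (s : 'I_n -> T -> S),
    [/\ (forall i, measurable (Ti i)),
        (forall i, borel_measurable_on (Ti i) (s i)),
        (exists T0 : set T, [/\ measurable T0, mu (~` T0) = 0%E &
           forall t, T0 t -> Gam t = [set x | exists i, Ti i t /\ s i t = x]])
      & (forall (i j : 'I_n) (t : T), i != j -> Ti i t -> Ti j t ->
           s i t != s j t)].
Proof.
move=> hS sS _ GamP /completion_prod_sigma_ae[E [Z [mE mZ Z0 GE]]].
have [U UB] := separable_open_basis sS.
(* Emptying the sections over [Z] makes the cardinality bound on [Gam t] valid for every section of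
   [E']. *)
pose E' := E `&` fst @^-1` (~` Z).
have E'P t x : E' (t, x) <-> ~ Z t /\ Gam t x.
  by split=> [[Ex nZ]|[nZ Gx]]; split => //; apply/(GE t x nZ).
have mE' : measurable E'.
  apply: measurableI => //; rewrite -[_ @^-1` _]setTI.
  by apply: measurable_fst => //; exact: measurableC.
have [t|Ti [s [Z' [mTs [mZ' Z'0] TE ET Tij]]]] :=
    finite_sections_enumeration mu UB hS sS (N := N) mE'.
  have [_ finG cG] := GamP t; exists (fset_set (Gam t)) => // x /E'P[_ Gx].
  by rewrite in_fset_set//; exact: mem_set.
exists N; split => //; exists (fun i => Ti i), (fun i => s i); split.
- by move=> i; have [] := mTs i.
- by move=> i; have [] := mTs i.
- exists (~` (Z `|` Z')); split.
  + by apply: measurableC; exact: measurableU.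
  + rewrite setCK; apply: measure_negligible; first exact: measurableU.
    by apply: negligibleU; exact/negligibleP.
  + move=> t /not_orP[nZ nZ']; apply/seteqP; split=> [x Gx|x [i [Tt <-]]].
      have [i iN [Tt sx]] := ET t x nZ' ((E'P t x).2 (conj nZ Gx)).
      by exists (Ordinal iN).
    by have /E'P[] := TE _ _ Tt.
- by move=> i j t ij; exact: Tij.
Qed.
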